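(* Let $\lambda_1(A)$ be a regular Köthe space. Then $\lambda_1(A)$ has a prominent set if and only if it satisfies $(\overline{\Omega})$.
   Context: Köthe spaces: for a matrix $A=(a_k(n))_{(k,n)\in\mathbb{N}_0^2}$ of positive weights with $a_k(n)\le a_{k+1}(n)$ for all $k,n$, the Köthe space (of order 1) is $\lambda_1(A)=\{(x_n)_{n\in\mathbb{N}_0}\in\mathbb{C}^{\mathbb{N}_0}: \|x\|_k=\sum_{n=0}^\infty a_k(n)|x_n|<\infty \text{ for all } k\in\mathbb{N}_0\}$, a Fréchet space with the fundamental sequence of seminorms $(\|\cdot\|_k)_{k\in\mathbb{N}_0}$. The space and the matrix are called regular if $n\mapsto a_k(n)/a_{k+1}(n)$ is decreasing (non-increasing) for every $k\in\mathbb{N}_0$. Prominent sets: let $X$ be a locally convex space and $\mathscr{U}_0(X)$ the system of its absolutely convex $0$-neighbourhoods. For $n\in\mathbb{N}_0$, $V\subseteq X$ and an absolutely convex set $U\subseteq X$, the $n$-th Kolmogorov width is $\delta_n(V,U)=\inf\{\delta>0: V\subseteq \delta U+L$ for an at most $n$-dimensional linear subspace $L$ of $X\}$ (with $\inf\emptyset=+\infty$). The diametral dimension of $X$ is $\Delta(X)=\{(\xi_n)_{n\in\mathbb{N}_0}\in\mathbb{R}^{\mathbb{N}_0}: \forall U\in\mathscr{U}_0(X)\ \exists V\in\mathscr{U}_0(X) \text{ with } \xi_n\delta_n(V,U)\to 0\}$. A bounded subset $B$ of $X$ is called prominent if $\Delta(X)=\{\xi\in\mathbb{R}^{\mathbb{N}_0}: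 \xi_n\delta_n(B,U)\to 0 \text{ for all } U\in\mathscr{U}_0(X)\}$. Condition $(\overline{\Omega})$: a Fréchet space $X$ with an increasing fundamental sequence of seminorms $(\|\cdot\|_k)_k$ and corresponding dual norms $\|\varphi\|_k^*=\sup\{|\varphi(x)|:\|x\|_k\le 1\}\in[0,\infty]$ for $\varphi\in X'$ (the topological dual) satisfies $(\overline{\Omega})$ if for every $k$ there is $\ell\ge k$ such that for every $m\ge\ell$ there is $C>0$ with $(\|\varphi\|_\ell^* )^2\le C\,\|\varphi\|_k^*\,\|\varphi\|_m^*$ for all $\varphi\in X'$. *)

(* Defs.v *)
From HB Require Import structures.
From mathcomp Require Import all_boot all_order all_algebra.
From mathcomp Require Import all_classical all_reals all_analysis.
From mathcomp Require Import complex.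

Set Implicit Arguments.
Unset Strict Implicit.
Unset Printing Implicit Defensive.
Import Order.TTheory GRing.Theory Num.Theory.
Import numFieldNormedType.Exports.
Import ComplexField.Normc.

Local Open Scope classical_set_scope.
Local Open Scope ring_scope.
Local Open Scope complex_scope.

Section locally_convex.
Context {R : realType} {X : tvsType R[i]}.
Implicit Types (U V B L : set X) (n : nat).

Definition absolutely_convex U :=
  forall (a b : R[i]) (x y : X),
    `|a| + `|b| <= 1 -> U x -> U y -> U (a *: x + b *: y).

Definition absconvex_nbhs0 : set (set X) :=
  [set U | nbhs (0 : X) U /\ absolutely_convex U].

Definition dilate (d : R) U : set X := [set d%:C *: u | u in U].

(* A linear subspace has dimension at most n iff it is spanned by n vectors,
   which need not be independent. *)
Definition span_of n (v : 'I_n -> X) : set X :=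
  [set \sum_(i < n) c i *: v i | c in [set: 'I_n -> R[i]]].

Definition subspace_dim_le n L := exists v : 'I_n -> X, L = span_of v.

Definition kolmogorov_width n V U : \bar R :=
  ereal_inf [set d%:E | d in [set d : R | 0 < d /\
    exists2 L, subspace_dim_le n L &
      V `<=` [set u + l | u in dilate d U & l in L]]].

Definition bounded_subset B :=
  forall U, nbhs (0 : X) U -> exists2 r : R, 0 < r & B `<=` dilate r U.

(* With the convention 0 * +oo = 0. This is harmless: the widths are finite when
   V is bounded, and in the diametral dimension V may be shrunk to V `&` U. *)
Definition width_null (xi : nat -> R) V U : Prop :=
  ((xi n)%:E * kolmogorov_width n V U)%E @[n --> \oo] --> 0%E.

End locally_convex.

Definition diametral_dimension {R : realType} (X : tvsType R[i]) :
    set (nat -> R) :=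
  [set xi | forall U : set X, absconvex_nbhs0 U ->
    exists2 V : set X, absconvex_nbhs0 V & width_null xi V U].

Definition prominent {R : realType} (X : tvsType R[i]) (B : set X) :=
  bounded_subset B /\
  diametral_dimension X =
    [set xi | forall U : set X, absconvex_nbhs0 U -> width_null xi B U].

Definition has_prominent_set {R : realType} (X : tvsType R[i]) :=
  exists B : set X, prominent B.

Definition dual_norm {R : realType} (X : tvsType R[i]) (p : X -> R)
    (phi : X -> R[i]) : \bar R :=
  ereal_sup [set (normc (phi x))%:E | x in [set x | p x <= 1]].

(* [p] is meant to be an increasing fundamental system of seminorms of [X]. *)
Definition Omega_bar {R : realType} (X : tvsType R[i]) (p : nat -> X -> R) :=
  forall k, exists2 l, (k <= l)%N &
  forall m, (l <= m)%N -> exists2 C : R, 0 < C &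
  forall phi : {linear X -> (R[i])^o}, continuous phi ->
    (dual_norm (p l) phi ^+ 2 <=
     C%:E * dual_norm (p k) phi * dual_norm (p m) phi)%E.

Record kothe_matrix (R : realType) := KotheMatrix {
  weight :> nat -> nat -> R ;
  weight_gt0 : forall k n, 0 < weight k n ;
  weight_leS : forall k n, weight k n <= weight k.+1 n }.

Definition regular {R : realType} (A : kothe_matrix R) :=
  forall k, nonincreasing_seq (fun n => A k n / A k.+1 n).

Section kothe_sequences.
Context {R : realType} (A : kothe_matrix R).
Implicit Types (x y : nat -> R[i]).

Definition kothe_sum k x : \bar R :=
  (\sum_(0 <= n <oo) (A k n * normc (x n))%:E)%E.

Definition kothe_pred : {pred nat -> R[i]} :=
  [pred x | `[< forall k, (kothe_sum k x < +oo)%E >]].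

Lemma normc_ge0 (z : R[i]) : 0 <= normc z.
Proof. by case: z => a b; exact: sqrtr_ge0. Qed.

Lemma weight_le k l n : (k <= l)%N -> A k n <= A l n.
Proof.
move=> /subnK <-; elim: (l - k)%N => [//|d ih].
by rewrite addSn (le_trans ih)// weight_leS.
Qed.

Let term_ge0 k x n : (0 <= (A k n * normc (x n))%:E)%E.
Proof. by rewrite lee_fin mulr_ge0 ?normc_ge0// ltW// weight_gt0. Qed.

Lemma kothe_sum_ge0 k x : (0 <= kothe_sum k x)%E.
Proof. by apply: nneseries_ge0 => n _ _; exact: term_ge0. Qed.

Lemma kothe_sum_le k l x : (k <= l)%N -> (kothe_sum k x <= kothe_sum l x)%E.
Proof.
move=> kl; apply: lee_nneseries => n _ //.
by rewrite lee_fin ler_wpM2r ?normc_ge0// weight_le.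
Qed.

Lemma kothe_sumD k x y :
  (kothe_sum k (x + y)%R <= kothe_sum k x + kothe_sum k y)%E.
Proof.
rewrite /kothe_sum -nneseriesD//; apply: lee_nneseries => n _ //.
by rewrite -EFinD lee_fin -mulrDr ler_wpM2l ?le_normcD// ltW// weight_gt0.
Qed.

Lemma kothe_sumZ k (a : R[i]) x :
  kothe_sum k (a *: x)%R = ((normc a)%:E * kothe_sum k x)%E.
Proof.
rewrite /kothe_sum -nneseriesZl//; apply: eq_eseriesr => n _.
by rewrite -EFinM mulrCA -normcM.
Qed.

Lemma kothe_sum0 k : kothe_sum k 0 = 0%E.
Proof.
by apply: eseries0 => n _ _; rewrite -[X in normc X]/0 normc0 mulr0.
Qed.

Lemma kothe_submod_closed : submod_closed kothe_pred.
Proof.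
split; first by apply/asboolP => k; rewrite kothe_sum0.
move=> a x y /asboolP xA /asboolP yA; apply/asboolP => k.
apply: (le_lt_trans (kothe_sumD _ _ _)); rewrite kothe_sumZ.
by rewrite lte_add_pinfty// lte_mul_pinfty// lee_fin normc_ge0.
Qed.

HB.instance Definition _ :=
  GRing.isSubmodClosed.Build R[i] (nat -> R[i]) kothe_pred kothe_submod_closed.

End kothe_sequences.

(* The Köthe space of order 1. *)
Record kothe {R : realType} (A : kothe_matrix R) := Kothe {
  kothe_seq :> nat -> R[i] ;
  kothe_seqP : kothe_seq \in kothe_pred A }.

Section kothe_space.
Context {R : realType} (A : kothe_matrix R).
Local Notation E := (kothe A).

HB.instance Definition _ := [isSub for @kothe_seq R A].
HB.instance Definition _ := [Choice of E by <:].
HB.instance Definition _ := [SubChoice_isSubLmodule of E by <:].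

Definition kothe_norm k (x : E) : R := fine (kothe_sum A k x).

Lemma kothe_sum_fin k (x : E) : kothe_sum A k x \is a fin_num.
Proof.
by rewrite ge0_fin_numE ?kothe_sum_ge0//; have /asboolP := kothe_seqP x.
Qed.

Lemma kothe_normE k (x : E) : (kothe_norm k x)%:E = kothe_sum A k x.
Proof. by rewrite /kothe_norm fineK// kothe_sum_fin. Qed.

Lemma kothe_norm_ge0 k (x : E) : 0 <= kothe_norm k x.
Proof. by rewrite -lee_fin kothe_normE kothe_sum_ge0. Qed.

Lemma kothe_norm_le k l (x : E) : (k <= l)%N -> kothe_norm k x <= kothe_norm l x.
Proof. by move=> kl; rewrite -lee_fin !kothe_normE kothe_sum_le. Qed.

Lemma kothe_normD k (x y : E) :
  kothe_norm k (x + y) <= kothe_norm k x + kothe_norm k y.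
Proof. by rewrite -lee_fin EFinD !kothe_normE kothe_sumD. Qed.

Lemma kothe_normZ k (a : R[i]) (x : E) :
  kothe_norm k (a *: x) = normc a * kothe_norm k x.
Proof. by apply: EFin_inj; rewrite EFinM !kothe_normE kothe_sumZ. Qed.

Lemma kothe_norm0 k : kothe_norm k 0 = 0.
Proof. by apply: EFin_inj; rewrite kothe_normE kothe_sum0. Qed.

Lemma kothe_normN k (x : E) : kothe_norm k (- x) = kothe_norm k x.
Proof. by rewrite -scaleN1r kothe_normZ normcN normc1 mul1r. Qed.

Definition kothe_ball (x : E) k (e : R) : set E :=
  [set y | kothe_norm k (y - x) < e].

(* The topology generated by the seminorms [kothe_norm k]. *)
Definition kothe_nbhs (x : E) : set_system E :=
  filter_from [set ke : nat * R | 0 < ke.2] (fun ke => kothe_ball x ke.1 ke.2).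

HB.instance Definition _ := hasNbhs.Build E kothe_nbhs.

Lemma kothe_nbhsP (x : E) (U : set E) :
  nbhs x U <-> exists k, exists2 e : R, 0 < e & kothe_ball x k e `<=` U.
Proof.
split=> [[[k e] /= e0 sU]|[k [e e0 sU]]]; first by exists k, e.
by exists (k, e).
Qed.

Let kothe_ball_center (x : E) k (e : R) : 0 < e -> kothe_ball x k e x.
Proof. by move=> e0; rewrite /kothe_ball /= subrr kothe_norm0. Qed.

Let nbhs_ball (x : E) k (e : R) : 0 < e -> nbhs x (kothe_ball x k e).
Proof. by move=> e0; apply/kothe_nbhsP; exists k, e. Qed.

Let nbhs_filter (x : E) : ProperFilter (nbhs x).
Proof.
apply: filter_from_proper => [|[k e] /= e0]; last first.
  by exists x; exact: kothe_ball_center.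
apply: filter_from_filter; first by exists (0%N, 1) => /=.
move=> [k e] [l d] /= e0 d0; exists (maxn k l, Num.min e d) => /=.
  by rewrite lt_min e0 d0.
move=> y; rewrite /kothe_ball /= lt_min => /andP[ye yd]; split.
  by apply: le_lt_trans ye; rewrite kothe_norm_le// leq_maxl.
by apply: le_lt_trans yd; rewrite kothe_norm_le// leq_maxr.
Qed.

Let nbhs_singleton (x : E) (U : set E) : nbhs x U -> U x.
Proof. by move=> /kothe_nbhsP[k [e e0]]; apply; exact: kothe_ball_center. Qed.

Let ball_nbhs (x y : E) k e : kothe_ball x k e y -> nbhs y (kothe_ball x k e).
Proof.
move=> xy; apply/kothe_nbhsP; exists k, (e - kothe_norm k (y - x)).
  by rewrite subr_gt0.
move=> z; rewrite /kothe_ball /= ltrBrDr; apply: le_lt_trans.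
by rewrite -[z - x](subrKA y) kothe_normD.
Qed.

Let nbhs_nbhs (x : E) (U : set E) : nbhs x U -> nbhs x (nbhs^~ U).
Proof.
move=> /kothe_nbhsP[k [e e0 sU]]; apply/kothe_nbhsP; exists k, e => // y /=.
by move=> /ball_nbhs; case=> ld ld0 sld; exists ld => //; exact: subset_trans sU.
Qed.

HB.instance Definition _ :=
  Nbhs_isNbhsTopological.Build E nbhs_filter nbhs_singleton nbhs_nbhs.

Let add_continuous : continuous (fun z : E * E => z.1 + z.2).
Proof.
move=> [x y] U /= /kothe_nbhsP[k [e e0 sU]].
exists (kothe_ball x k (e / 2), kothe_ball y k (e / 2)) => /=.
  by split; apply: nbhs_ball; rewrite divr_gt0.
move=> [u v] /= [xu yv]; apply: sU.
rewrite /kothe_ball /= opprD addrACA (le_lt_trans (kothe_normD _ _ _))//.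
by rewrite (splitr e) ltrD.
Qed.

Let scale_continuous : continuous (fun z : (R[i])^o * E => z.1 *: z.2).
Proof.
move=> [a x] U /= /kothe_nbhsP[k [e e0 sU]].
pose r := normc a + 1; pose s := kothe_norm k x + 1.
have r0 : 0 < r by rewrite ltr_wpDl// normc_ge0.
have s0 : 0 < s by rewrite ltr_wpDl// kothe_norm_ge0.
pose d := Num.min 1 (e / 2 / s).
have d0 : 0 < d by rewrite lt_min ltr01 !divr_gt0.
exists (ball (a : (R[i])^o) d%:C, kothe_ball x k (e / 2 / r)) => /=.
  split; last by apply: nbhs_ball; rewrite !divr_gt0.
  by apply: nbhsx_ballx; rewrite ltcR.
move=> [b y] /= [ab xy]; apply: sU; rewrite /kothe_ball /= in xy *.
have {}ab : normc (b - a) < d by rewrite -normcN opprB -ltcR.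
move: ab; rewrite lt_min => /andP[ab1 abs].
have br : normc b <= r.
  rewrite -(subrK a b) (le_trans (le_normcD _ _))// addrC /r lerD2l.
  exact: ltW.
have -> : b *: y - a *: x = b *: (y - x) + (b - a) *: x.
  by rewrite scalerBr scalerBl subrKA.
rewrite (le_lt_trans (kothe_normD _ _ _))// !kothe_normZ (splitr e).
rewrite ltr_leD//.
  rewrite (@le_lt_trans _ _ (r * kothe_norm k (y - x)))//.
    by rewrite ler_wpM2r// kothe_norm_ge0.
  by rewrite mulrC -ltr_pdivlMr.
rewrite (@le_trans _ _ (e / 2 / s * kothe_norm k x))//.
  by rewrite ler_wpM2r ?kothe_norm_ge0// ltW.
rewrite -[leRHS](divfK (lt0r_neq0 s0)) ler_wpM2l ?divr_ge0 ?ltW//.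
by rewrite ltrDl.
Qed.

Let locally_convex :
  exists2 B : set_system E, (forall b, b \in B -> convex_set b) & basis B.
Proof.
exists [set B | exists x k e, B = kothe_ball x k e].
  move=> _ /[!inE] -[x [k [e ->]]]; apply/convex_setW => y z.
  rewrite !inE /kothe_ball /= => yx zx l l0 l1; rewrite inE /=.
  have lE : l%:num = (complex.Re l%:num)%:C by rewrite RRe_real// gtr0_real.
  move: l0 l1; set t := complex.Re l%:num in lE *; rewrite lE.
  rewrite -[0]/(0%:C) -[1]/(1%:C) !ltcR => t0 t1.
  have -> : conv l y z - x = t%:C *: (y - x) + (1 - t)%:C *: (z - x).
    rewrite -[X in X - x]/(l%:num *: (y : E) + (1 - l%:num) *: (z : E)) lE.
    by rewrite rmorphB rmorph1 !scalerBr addrACA -opprD -scalerDl subrKC scale1r.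
  rewrite (le_lt_trans (kothe_normD _ _ _))// !kothe_normZ.
  have normcE (u : R) : 0 < u -> normc u%:C = u.
    by move=> u0; rewrite /normc/= expr0n addr0 sqrtr_sqr gtr0_norm.
  rewrite !normcE ?subr_gt0// -[ltRHS]mul1r -[in ltRHS](subrKC t 1).
  by rewrite [ltRHS]mulrDl ltrD// ltr_pM2l// subr_gt0.
split=> [_ [x [k [e ->]]]|x U].
  by rewrite openE => y; exact: ball_nbhs.
move=> /kothe_nbhsP[k [e e0 sU]]; exists (kothe_ball x k e) => //.
by split; [exists x, k, e|exact: kothe_ball_center].
Qed.

(* This factory only provides the uniform structure. *)
HB.instance Definition _ := PreTopologicalLmod_isTvs.Build R[i] E
  add_continuous scale_continuous locally_convex.
HB.instance Definition _ :=
  PreTopologicalNmodule_isTopologicalNmodule.Build E add_continuous.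
HB.instance Definition _ :=
  TopologicalNmodule_isTopologicalLmodule.Build R[i] E scale_continuous.
HB.instance Definition _ := Uniform_isTvs.Build R[i] E locally_convex.

End kothe_space.

(* Main.v *)
From HB Require Import structures.
Require Import Defs.
From mathcomp Require Import all_boot all_order all_algebra.
From mathcomp Require Import all_classical all_reals all_analysis complex ring.

(* For a regular matrix the width of the unit ball U_l with respect to U_k is
   delta_n(U_l, U_k) = a_k(n) / a_l(n): tails give the upper bound, and an
   (n+1)-dimensional coordinate section gives the lower one. Testing on
   coordinate functionals, Omega-bar becomes: for every k there is l such that
   a_k a_m = O(a_l ^ 2) for every m.

   If this holds with constants C_{k,m}, choose D_m so large that the bounded
   set B of all x with ||x||_m <= D_m for every m contains, up to a factor s_k,
   the vectors a_k(j) / a_l(j) ^ 2 e_j. Then a_k(n) / a_l(n) =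
   O(delta_n(B, U_l)), and B is prominent.

   Conversely, if B is prominent then a_k(n) / a_l(n) = O(delta_n(B, U_l)) for
   some l: otherwise a sparse sequence with values a_{k+j} / a_k at well chosen
   places n_j is killed by all delta_n(B, U) but is not in the diametral
   dimension. As B is absorbed by U_m, delta_n(B, U_l) = O(a_l(n) / a_m(n)). *)

Set Implicit Arguments.
Unset Strict Implicit.
Unset Printing Implicit Defensive.
Import Order.TTheory GRing.Theory Num.Theory.
Import numFieldNormedType.Exports.
Import ComplexField.Normc.

Local Open Scope classical_set_scope.
Local Open Scope ring_scope.
Local Open Scope complex_scope.

(** * The modulus of complex numbers *)

Section complex_modulus.
Context {R : realType}.
Implicit Types (z : R[i]) (r : R).

Lemma normr_normc z : `|z| = (normc z)%:C.
Proof. by []. Qed.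

Lemma normc_gt0 z : (0 < normc z) = (z != 0).
Proof. by rewrite -normr_gt0 normr_normc ltcR. Qed.

Lemma normc_real r : 0 <= r -> normc r%:C = r.
Proof. by move=> r0; rewrite /normc/= expr0n addr0 sqrtr_sqr ger0_norm. Qed.

Lemma ler_normc_sum (I : Type) (s : seq I) (P : pred I) (F : I -> R[i]) :
  normc (\sum_(i <- s | P i) F i) <= \sum_(i <- s | P i) normc (F i).
Proof.
elim/big_ind2: _ => [|x r y t xr yt|//]; first by rewrite normc0.
by rewrite (le_trans (le_normcD _ _))// lerD.
Qed.

End complex_modulus.

(** * Kolmogorov widths and null sequences *)

Section widths.
Context {R : realType} {X : tvsType R[i]}.
Implicit Types (U V L : set X) (xi : nat -> R).

Lemma span_ofZ n (v : 'I_n -> X) (a : R[i]) (x : X) :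
  span_of v x -> span_of v (a *: x).
Proof.
move=> [c _ <-]; exists (fun i => a * c i) => //.
by rewrite scaler_sumr; apply: eq_bigr => i _; rewrite scalerA.
Qed.

Lemma kolmogorov_width_ge0 n V U : (0 <= kolmogorov_width n V U)%E.
Proof. by apply/ereal_infP => _ [d [d0 _] <-]; rewrite lee_fin ltW. Qed.

Lemma kolmogorov_width_le_of n V U L (d : R) :
  0 < d -> subspace_dim_le n L ->
  V `<=` [set u + l | u in dilate d U & l in L] ->
  (kolmogorov_width n V U <= d%:E)%E.
Proof.
move=> d0 nL VUL; apply: ereal_inf_lbound.
by exists d => //; split=> //; exists L.
Qed.

Lemma kolmogorov_width_ge_of n V U (c : R) :
  (forall d L, 0 < d -> subspace_dim_le n L ->
    V `<=` [set u + l | u in dilate d U & l in L] -> c <= d) ->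
  (c%:E <= kolmogorov_width n V U)%E.
Proof.
move=> H; apply/ereal_infP => _ [d [d0 [L nL VUL]] <-].
by rewrite lee_fin; exact: H VUL.
Qed.

(** Multiplying a covering of V' by d U' + L with r turns d u into (r d / s) (s u), while L is
    invariant under scaling. All later comparisons of widths under a change of V or U rest on
    this. *)
Lemma kolmogorov_width_dilate n V V' U U' (r s : R) :
  0 < r -> 0 < s -> V `<=` dilate r V' -> dilate s U' `<=` U ->
  (kolmogorov_width n V U <= (r / s)%:E * kolmogorov_width n V' U')%E.
Proof.
move=> r0 s0 VV' UU'.
rewrite -lee_pdivrMl ?divr_gt0//; apply/ereal_infP => _ [d [d0 [L nL VUL]] <-].
rewrite lee_pdivrMl ?divr_gt0// -EFinM.
apply: (@kolmogorov_width_le_of n V U L) => //;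
  first by rewrite !mulr_gt0 ?invr_gt0.
move=> _ /VV'[_ /VUL[_ [u U'u <-] [l Ll <-]] <-].
exists (r%:C *: (d%:C *: u)); last first.
  exists (r%:C *: l); last by rewrite scalerDr.
  by case: nL Ll => v -> ; exact: span_ofZ.
exists (s%:C *: u); first by apply: UU'; exists u.
rewrite !scalerA -!rmorphM/=; congr (_%:C *: _).
by rewrite mulrAC divfK ?gt_eqF.
Qed.

Lemma kolmogorov_width_subr n V U U' : U' `<=` U ->
  (kolmogorov_width n V U <= kolmogorov_width n V U')%E.
Proof.
move=> UU'; rewrite -[leRHS]mul1e -[X in X%:E]divr1.
apply: kolmogorov_width_dilate => // [x Vx|_ [x /UU' Ux <-]].
  by exists x => //; rewrite scale1r.
by rewrite scale1r.
Qed.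

(** A bound by a real e forces the product to be finite, so no separate finiteness of the widths has
    to be carried along. *)
Lemma width_nullP xi V U :
  width_null xi V U <-> forall e : R, 0 < e -> exists N, forall n, (N <= n)%N ->
    (`|xi n|%:E * kolmogorov_width n V U <= e%:E)%E.
Proof.
have absE n : (`|(xi n)%:E * kolmogorov_width n V U| =
    `|xi n|%:E * kolmogorov_width n V U)%E.
  by rewrite abseM abse_EFin (gee0_abs (kolmogorov_width_ge0 _ _ _)).
rewrite /width_null -cvg_abse0P; split=> [|H].
  move=> /fine_cvgP[] [N1 _ fin] /cvgr0Pnorm_le H e e0.
  have [N2 _ N2e] := H e e0.
  exists (maxn N1 N2) => n; rewrite geq_max => /andP[n1 n2].
  have /= := N2e _ n2; rewrite ger0_norm ?fine_ge0 ?abse_ge0//.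
  by rewrite -lee_fin fineK ?absE//; have /= := fin _ n1; rewrite absE.
apply/fine_cvgP; split.
  have [N N1] := H 1 ltr01.
  exists N => // n /= /N1; rewrite absE => h.
  by rewrite ge0_fin_numE ?mule_ge0 ?kolmogorov_width_ge0// (le_lt_trans h)//
    ltry.
apply/cvgr0Pnorm_le => e e0; have [N Ne] := H _ e0.
exists N => // n /= /Ne h; rewrite absE ger0_norm ?fine_ge0 ?mule_ge0
  ?kolmogorov_width_ge0//.
by rewrite -lee_fin fineK// ge0_fin_numE ?mule_ge0 ?kolmogorov_width_ge0//
  (le_lt_trans h)// ltry.
Qed.

Lemma width_null_le xi V U V' U' (c : R) (N : nat) : 0 < c ->
  (forall n, (N <= n)%N ->
    (kolmogorov_width n V U <= c%:E * kolmogorov_width n V' U')%E) ->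
  width_null xi V' U' -> width_null xi V U.
Proof.
move=> c0 le_w /width_nullP null; apply/width_nullP => e e0.
have [M Me] := null (e / c) (divr_gt0 e0 c0).
exists (maxn N M) => n; rewrite geq_max => /andP[/le_w h /Me].
rewrite [e / c]mulrC EFinM lee_pdivlMl// => h'; apply: le_trans h'.
by rewrite muleCA lee_wpmul2l// lee_fin.
Qed.

(** Any bounded B is absorbed by the V that witnesses membership in the diametral dimension. This
    inclusion is the free half of prominence. *)
Lemma diametral_dimension_sub_bounded (B : set X) : bounded_subset B ->
  diametral_dimension X `<=`
  [set xi | forall U, absconvex_nbhs0 U -> width_null xi B U].
Proof.
move=> bB xi xiX U /[dup] nU /xiX[V [nV _] VU].
have [r r0 BV] := bB _ nV.
apply: (@width_null_le _ _ _ V U r 0) => // n _.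
rewrite -[r]divr1; apply: kolmogorov_width_dilate => //.
by move=> _ [u Uu <-]; rewrite scale1r.
Qed.

End widths.

(** * Coordinate vectors, heads and tails *)

Section kothe_space.
Context {R : realType} (A : kothe_matrix R).
Local Notation E := (kothe A).
Implicit Types (x y : E) (k l m n : nat).

Lemma kothe_seqD x y n : (x + y) n = x n + y n.
Proof. by []. Qed.

Lemma kothe_seqN x n : (- x) n = - x n.
Proof. by []. Qed.

Lemma kothe_seqZ (a : R[i]) x n : (a *: x) n = a * x n.
Proof. by []. Qed.

Lemma kothe_seq_sum (I : Type) (s : seq I) (P : pred I) (F : I -> E) n :
  (\sum_(i <- s | P i) F i) n = \sum_(i <- s | P i) F i n.
Proof. exact: (big_morph (fun x : E => x n) (fun x y => kothe_seqD x y n)). Qed.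

Let term_ge0 k (x : nat -> R[i]) n : 0 <= A k n * normc (x n).
Proof. by rewrite mulr_ge0 ?normc_ge0// ltW// weight_gt0. Qed.

Lemma kothe_sum_delta k n :
  kothe_sum A k (fun j => (j == n)%:R) = (A k n)%:E.
Proof.
rewrite /kothe_sum (@nneseriesD1 _ _ n)//=; last first.
  by move=> j _; rewrite lee_fin (term_ge0 k (fun i => (i == n)%:R)).
rewrite eqxx normc1 mulr1 eseries0 ?adde0// => j _ /negbTE ->.
by rewrite normc0 mulr0.
Qed.

Lemma kothe_delta_subproof n : (fun j => (j == n)%:R) \in kothe_pred A.
Proof. by apply/asboolP => k; rewrite kothe_sum_delta ltry. Qed.

Definition kothe_delta n : E := Kothe (kothe_delta_subproof n).

Lemma kothe_norm_delta k n : kothe_norm k (kothe_delta n) = A k n.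
Proof. by apply: EFin_inj; rewrite kothe_normE kothe_sum_delta. Qed.

Lemma kothe_norm_psum k x n :
  \sum_(j < n) A k j * normc (x j) <= kothe_norm k x.
Proof.
rewrite -lee_fin kothe_normE -(big_mkord xpredT (fun j => A k j * normc (x j))).
rewrite -sumEFin; apply: (nneseries_lim_ge (m := 0)) => j _ _.
by rewrite lee_fin term_ge0.
Qed.

Lemma kothe_norm_coord k x n : A k n * normc (x n) <= kothe_norm k x.
Proof.
apply: le_trans (kothe_norm_psum k x n.+1).
by rewrite big_ord_recr/= lerDr sumr_ge0.
Qed.

Lemma kothe_norm_scale_le k l (c : R) x y : 0 <= c ->
  (forall j, A k j * normc (y j) <= c * (A l j * normc (x j))) ->
  kothe_norm k y <= c * kothe_norm l x.
Proof.
move=> c0 yx; rewrite -lee_fin EFinM !kothe_normE /kothe_sum -nneseriesZl//.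
  by apply: lee_nneseries => j _; rewrite ?lee_fin// -?EFinM lee_fin.
by move=> j _; rewrite lee_fin.
Qed.

Definition kothe_head n x : E := \sum_(j < n) x j *: kothe_delta j.

Lemma kothe_headE n x j : kothe_head n x j = if (j < n)%N then x j else 0.
Proof.
rewrite /kothe_head kothe_seq_sum; case: ltnP => jn.
  rewrite (bigD1 (Ordinal jn))// kothe_seqZ/= eqxx mulr1 big1 ?addr0// => i ij.
  have /negbTE ji : j != i by apply: contra ij => /eqP ji; exact/eqP/val_inj.
  by rewrite -[LHS]/(x i * (j == i)%:R) ji mulr0.
rewrite big1// => i _; rewrite -[LHS]/(x i * (j == i)%:R) gtn_eqF ?mulr0//.
exact: leq_trans (ltn_ord i) jn.
Qed.

Lemma kothe_tailE n x j : (x - kothe_head n x) j = if (j < n)%N then 0 else x j.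
Proof.
by rewrite kothe_seqD kothe_seqN kothe_headE; case: ifP; rewrite ?subrr ?subr0.
Qed.

Lemma kothe_norm_tail k n x :
  (kothe_norm k (x - kothe_head n x))%:E =
  (\sum_(n <= j <oo) (A k j * normc (x j))%:E)%E.
Proof.
rewrite kothe_normE /kothe_sum (nneseries_split 0 n)//; last first.
  by move=> j _; rewrite lee_fin.
rewrite big_nat big1 ?add0e => [|j /andP[_ jn]]; last first.
  by rewrite kothe_tailE jn normc0 mulr0.
rewrite eseries_cond [RHS]eseries_cond; apply: eq_eseriesr => j /andP[_ nj].
by rewrite kothe_tailE ltnNge nj.
Qed.

(** The error in each seminorm is a tail of a convergent series. Hence a continuous functional is
    determined by its values on the coordinate vectors. *)
Lemma kothe_head_cvg x : kothe_head n x @[n --> \oo] --> x.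
Proof.
move=> U /kothe_nbhsP[k [e e0 sU]].
have fin : (\sum_(0 <= j <oo) (A k j * normc (x j))%:E < +oo)%E.
  by rewrite -[X in (X < _)%E]/(kothe_sum A k x) -kothe_normE ltry.
have {fin} := nneseries_tail_cvg fin (fun j _ => term_ge0 k x j).
under eq_fun do rewrite -kothe_norm_tail.
move=> /fine_cvg/cvgr0Pnorm_lt/(_ _ e0)[N _ small].
exists N => // n /small /= xe; apply: sU.
by rewrite /kothe_ball/= -opprB kothe_normN (le_lt_trans _ xe)// ler_norm.
Qed.

End kothe_space.

(** * Unit balls, boundedness and widths under regularity *)

Section kothe_widths.
Context {R : realType} (A : kothe_matrix R).
Local Notation E := (kothe A).
Implicit Types (x y : E) (k l m n : nat).

Let weight_ge0 k n : 0 <= A k n.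
Proof. exact/ltW/weight_gt0. Qed.

Let weight_neq0 k n : A k n != 0.
Proof. exact/lt0r_neq0/weight_gt0. Qed.

(** The ratio telescopes into consecutive ratios, each non-increasing by regularity. *)
Lemma regular_le k l i j : regular A -> (k <= l)%N -> (i <= j)%N ->
  A k j / A l j <= A k i / A l i.
Proof.
move=> regA /subnK <- ij; elim: (l - k)%N => [|d ih].
  by rewrite !divff.
have split_ratio n : A k n / A (d.+1 + k)%N n =
    A k n / A (d + k)%N n * (A (d + k)%N n / A (d.+1 + k)%N n).
  by rewrite mulrA divfK.
by rewrite !split_ratio ler_pM// ?divr_ge0//; exact: regA.
Qed.

Definition kothe_unit k : set E := [set x | kothe_norm k x <= 1].

Lemma kothe_unit_absconvex k : absconvex_nbhs0 (kothe_unit k).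
Proof.
split; first by apply/kothe_nbhsP; exists k, 1 => // x;
  rewrite /kothe_ball/= subr0 => /ltW.
move=> a b x y; rewrite !normr_normc -rmorphD lecR /kothe_unit/= => ab x1 y1.
rewrite (le_trans (kothe_normD _ _ _))// !kothe_normZ (le_trans _ ab)//.
by rewrite lerD// ler_piMr ?normc_ge0.
Qed.

(** The unit balls shrink as l grows, so one s serves all l from k on. It is half a radius because
    [kothe_ball] is open and [kothe_unit] is closed. *)
Lemma nbhs_kothe_unit (U : set E) : nbhs (0 : E) U ->
  exists k, exists2 s : R, 0 < s &
    forall l, (k <= l)%N -> dilate s (kothe_unit l) `<=` U.
Proof.
move=> /kothe_nbhsP[k [e e0 sU]]; have e20 : 0 < e / 2 by rewrite divr_gt0.
exists k, (e / 2) => // l kl _ [x x1 <-]; apply: sU;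
  rewrite /kothe_ball/= subr0 kothe_normZ.
rewrite normc_real ?(ltW e20)// (@le_lt_trans _ _ (e / 2 * 1))//.
  by rewrite ler_wpM2l ?(ltW e20)// (le_trans (kothe_norm_le _ kl)).
by rewrite mulr1 ltr_pdivrMr// ltr_pMr// ltr1n.
Qed.

Lemma kothe_bounded_subset (B : set E) :
  (forall m, exists D : R, forall x, B x -> kothe_norm m x <= D) ->
  bounded_subset B.
Proof.
move=> H U /nbhs_kothe_unit[k [s s0 sU]]; have [D BD] := H k.
(* The given bound D may be zero, or negative if B is empty; the dilation factor must be
   positive. *)
pose D' := Num.max D 1; have D0 : 0 < D' by rewrite lt_max ltr01 orbT.
exists (D' / s); first by rewrite divr_gt0.
move=> x Bx; exists ((s / D')%:C *: x); last first.
  by rewrite scalerA -rmorphM/= mulrA divfK ?gt_eqF// divff ?gt_eqF// scale1r.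
apply: (sU k) => //; exists (D'^-1%:C *: x); last by rewrite scalerA -rmorphM.
rewrite /kothe_unit/= kothe_normZ normc_real ?invr_ge0 ?(ltW D0)//.
by rewrite ler_pdivrMl// mulr1 le_max BD.
Qed.

Lemma bounded_subset_kothe (B : set E) m : bounded_subset B ->
  exists2 r : R, 0 < r & B `<=` dilate r (kothe_unit m).
Proof. by apply; case: (kothe_unit_absconvex m). Qed.

Lemma kothe_width_le l m n : regular A -> (l <= m)%N ->
  (kolmogorov_width n (kothe_unit m) (kothe_unit l) <= (A l n / A m n)%:E)%E.
Proof.
move=> regA lm; have c0 : 0 < A l n / A m n by rewrite divr_gt0 ?weight_gt0.
apply: (@kolmogorov_width_le_of _ _ _ _ _
  (span_of (fun i : 'I_n => kothe_delta A i))) => //.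
  by exists (fun i : 'I_n => kothe_delta A i).
move=> x x1; exists (x - kothe_head n x); last first.
  by exists (kothe_head n x); rewrite ?subrK//; exists (fun i : 'I_n => x i).
exists ((A l n / A m n)^-1%:C *: (x - kothe_head n x)); last first.
  by rewrite scalerA -rmorphM/= divff ?gt_eqF// scale1r.
rewrite /kothe_unit/= kothe_normZ normc_real ?invr_ge0 ?(ltW c0)//.
rewrite ler_pdivrMl// (@le_trans _ _ (A l n / A m n * kothe_norm m x))//.
  (* Only coordinates j >= n survive in the tail, and there regularity bounds the ratio of weights
     by its value at n. *)
  apply: kothe_norm_scale_le => [|j]; first exact: ltW.
  rewrite kothe_tailE; case: ltnP => nj.
    by rewrite normc0 mulr0 !mulr_ge0 ?invr_ge0 ?normc_ge0.
  by rewrite mulrA ler_wpM2r ?normc_ge0// -ler_pdivrMr ?weight_gt0// regular_le.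
by rewrite ler_wpM2l// ltW.
Qed.

(* A functional in the first [n.+1] coordinates that kills the subspace attains
   its norm at a coordinate vector, as the norms are weighted l1-norms. *)
Lemma kothe_width_ge l n (B : set E) (c : R) (t : nat -> R) :
  (forall j, (j <= n)%N ->
    [/\ 0 < t j, B ((t j)%:C *: kothe_delta A j) & c <= t j * A l j]) ->
  (c%:E <= kolmogorov_width n B (kothe_unit l))%E.
Proof.
move=> Bt; apply: kolmogorov_width_ge_of => d L d0 [v ->] BUL.
pose M := \matrix_(j < n.+1, i < n) (v i) j.
(* M has n+1 rows and n columns, so some nonzero u annihilates it from the left; the functional
   [phi] with coefficients u then vanishes on the span of v. *)
have : kermx M != 0.
  rewrite kermx_eq0 /row_free neq_ltn; apply/orP; left.
  by rewrite ltnS rank_leq_col.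
move=> /rowV0Pn[u /sub_kermxP uM u0].
pose phi (x : E) := \sum_(j < n.+1) u 0 j * x j.
have phiD x y : phi (x + y) = phi x + phi y.
  by rewrite -big_split; apply: eq_bigr => j _; rewrite kothe_seqD mulrDr.
have phiZ a x : phi (a *: x) = a * phi x.
  by rewrite mulr_sumr; apply: eq_bigr => j _; rewrite kothe_seqZ mulrCA.
have phi_delta (j : 'I_n.+1) : phi (kothe_delta A j) = u 0 j.
  rewrite /phi (bigD1 j)//= eqxx mulr1 big1 ?addr0// => i ij.
  by rewrite (_ : (i == j :> nat) = false) ?mulr0//; exact: negbTE.
have phiL x : span_of v x -> phi x = 0.
  move=> [a _ <-]; rewrite /phi.
  under eq_bigr do rewrite kothe_seq_sum mulr_sumr.
  rewrite exchange_big big1// => i _.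
  have := congr1 (fun w : 'rV_n => w 0 i) uM; rewrite !mxE => uMi.
  transitivity (a i * 0); last by rewrite mulr0.
  rewrite -[X in a i * X]uMi mulr_sumr; apply: eq_bigr => j _.
  by rewrite kothe_seqZ mxE mulrCA.
(* The maximum of g is the dual norm of [phi] for the l-th seminorm. *)
pose g (j : 'I_n.+1) := normc (u 0 j) / A l j.
pose j := [arg max_(i > ord0) g i]%O.
have gj i : g i <= g j by rewrite /j; case: arg_maxP => // k _; apply.
have gj0 : 0 < g j.
  have [i ui0] : exists i, u 0 i != 0.
    apply/existsP; apply: contraNT u0; rewrite negb_exists => /forallP ui0.
    by apply/eqP/rowP => i; rewrite mxE; apply/eqP; rewrite -[_ == _]negbK ui0.
  by apply: lt_le_trans (gj i); rewrite divr_gt0 ?weight_gt0// normc_gt0.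
have [tj Btj ctj] := Bt j (ltn_ord j).
apply: (le_trans ctj).
have [_ [y y1 <-] [z Lz yz]] := BUL _ Btj.
have : normc (phi y) <= g j.
  rewrite (le_trans (ler_normc_sum _ _ _))//.
  apply: (@le_trans _ _ (g j * \sum_(i < n.+1) A l i * normc (y i))).
    rewrite mulr_sumr ler_sum// => i _; rewrite normcM mulrA.
    rewrite ler_wpM2r ?normc_ge0// -ler_pdivrMr ?weight_gt0//; exact: gj.
  by rewrite ler_piMr ?(ltW gj0)// (le_trans (kothe_norm_psum _ _ _)).
(* Apply [phi] to the decomposition of t_j e_j: the part in L disappears, and dividing by g j leaves
   t_j a_l(j) <= d. *)
have : t j * normc (u 0 j) = d * normc (phi y).
  rewrite -[t j]normc_real ?(ltW tj)// -[d]normc_real ?(ltW d0)// -!normcM.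
  by rewrite -phi_delta -!phiZ -yz phiD (phiL z)// addr0.
have -> : normc (u 0 j) = g j * A l j by rewrite /g divfK.
move=> tE phiy; rewrite -(ler_pM2r gj0) -mulrA [A l j * _]mulrC tE.
by rewrite ler_pM2l.
Qed.

(** The normalised coordinate vectors e_j / a_l(j) lie in the l-th unit ball, and by regularity
    their k-norms for j <= n are smallest at j = n. *)
Lemma kothe_width_unit_ge k l n : regular A -> (k <= l)%N ->
  ((A k n / A l n)%:E <= kolmogorov_width n (kothe_unit l) (kothe_unit k))%E.
Proof.
move=> regA kl; apply: (@kothe_width_ge _ _ _ _ (fun j => (A l j)^-1)) => j jn.
have lj0 : 0 < (A l j)^-1 by rewrite invr_gt0 weight_gt0.
split=> //; last by rewrite [leRHS]mulrC regular_le.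
by rewrite /kothe_unit/= kothe_normZ kothe_norm_delta normc_real ?(ltW lj0)//
  mulVf.
Qed.

End kothe_widths.
Arguments kothe_unit {R} A k.

(** * Dual norms and the condition on the weights *)

Section kothe_dual.
Context {R : realType} (A : kothe_matrix R).
Local Notation E := (kothe A).
Implicit Types (x y : E) (k l m n : nat).

Definition kothe_coord n (x : E) : (R[i])^o := x n.

Lemma kothe_coord_is_linear n : linear (kothe_coord n).
Proof. by move=> a x y; rewrite /kothe_coord kothe_seqD kothe_seqZ. Qed.

HB.instance Definition _ n :=
  GRing.isLinear.Build R[i] E (R[i])^o *:%R (kothe_coord n)
    (kothe_coord_is_linear n).

Lemma kothe_coord_continuous n : continuous (kothe_coord n).
Proof.
move=> x; suff : kothe_coord n y @[y --> x] --> kothe_coord n x by [].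
(* A positive element of [R[i]] has zero imaginary part, so the tolerance is a real number. *)
apply/(cvgrPdist_lt (FF := @nbhs_filter E x)) => -[e e'] /[dup] /andP[/eqP ->
  _].
rewrite ltcR => e0; apply/kothe_nbhsP; exists 0%N, (e * A 0%N n).
  by rewrite mulr_gt0 ?weight_gt0.
move=> y; rewrite /kothe_ball/= => yx.
rewrite distrC normr_normc ltcR -(ltr_pM2r (weight_gt0 A 0%N n)).
by apply: le_lt_trans yx; rewrite mulrC; exact: (kothe_norm_coord 0 (y - x) n).
Qed.

Lemma dual_norm_ge0 k (phi : {linear E -> (R[i])^o}) :
  (0 <= dual_norm (@kothe_norm R A k) phi)%E.
Proof.
apply: (@le_trans _ _ (normc (phi 0))%:E); first by rewrite lee_fin normc_ge0.
by apply: ereal_sup_ubound; exists 0 => //=; rewrite kothe_norm0.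
Qed.

Lemma dual_norm_coord k n :
  dual_norm (@kothe_norm R A k) (kothe_coord n) = ((A k n)^-1)%:E.
Proof.
have kn0 := weight_gt0 A k n; apply/eqP; rewrite eq_le; apply/andP; split.
  apply/ereal_supP => _ [x x1 <-]; rewrite lee_fin.
  by rewrite -[leRHS]mulr1 ler_pdivlMl// (le_trans (kothe_norm_coord _ _ _)).
apply: ereal_sup_ubound; exists ((A k n)^-1%:C *: kothe_delta A n).
  by rewrite /= kothe_normZ kothe_norm_delta normc_real ?invr_ge0 ?(ltW kn0)//
    mulVf ?gt_eqF.
by rewrite /kothe_coord kothe_seqZ/= eqxx mulr1 normc_real// invr_ge0 ltW.
Qed.

Lemma dual_norm_delta_le k n (phi : {linear E -> (R[i])^o}) :
  ((normc (phi (kothe_delta A n)))%:E <=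
   (A k n)%:E * dual_norm (@kothe_norm R A k) phi)%E.
Proof.
have kn0 := weight_gt0 A k n.
rewrite -lee_pdivrMl//; apply: ereal_sup_ubound.
exists ((A k n)^-1%:C *: kothe_delta A n).
  by rewrite /= kothe_normZ kothe_norm_delta normc_real ?invr_ge0 ?(ltW kn0)//
    mulVf ?gt_eqF.
by rewrite linearZ normcM normc_real ?invr_ge0 ?(ltW kn0).
Qed.

(** On heads of x the bound follows by summing over coordinates; continuity carries it over to x.
    Together with [dual_norm_delta_le] it makes the dual norm a weighted sup-norm. *)
Lemma dual_norm_le k (phi : {linear E -> (R[i])^o}) (q : R) :
  continuous phi -> 0 <= q ->
  (forall n, normc (phi (kothe_delta A n)) <= q * A k n) ->
  (dual_norm (@kothe_norm R A k) phi <= q%:E)%E.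
Proof.
move=> phi_cont q0 phiq; apply/ereal_supP => _ [x x1 <-]; rewrite lee_fin.
have phix : phi (kothe_head n x) @[n --> \oo] --> phi x.
  exact: (cvg_comp (fun n => kothe_head n x) phi (@kothe_head_cvg _ _ x)
    (phi_cont x)).
rewrite leNgt; apply/negP => ltq.
have e0 : (0 : R[i]) < (normc (phi x) - q)%:C by rewrite ltcR subr_gt0.
move/cvgrPdist_lt/(_ _ e0): phix => [N _ /(_ N (leqnn N))].
rewrite /= normr_normc ltcR ltrBrDr => h.
have : normc (phi (kothe_head N x)) <= q.
  rewrite /kothe_head linear_sum (le_trans (ler_normc_sum _ _ _))//.
  apply: (@le_trans _ _ (q * \sum_(j < N) A k j * normc (x j))).
    rewrite mulr_sumr ler_sum// => j _; rewrite linearZ normcM mulrC mulrA.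
    by rewrite ler_wpM2r ?normc_ge0.
  by rewrite ler_piMr// (le_trans (kothe_norm_psum _ _ _)).
move=> hq.
have := le_normcD (phi x - phi (kothe_head N x)) (phi (kothe_head N x)).
rewrite subrK leNgt => /negP; apply; apply: le_lt_trans h.
by rewrite lerD2l.
Qed.

Definition weight_Omega_bar := forall k, exists2 l, (k <= l)%N &
  forall m, (l <= m)%N -> exists2 C : R, 0 < C &
  forall n, A k n * A m n <= C * A l n ^+ 2.

Lemma Omega_barP : Omega_bar (@kothe_norm R A) <-> weight_Omega_bar.
Proof.
split=> [Om k|Om k]; have [l kl Hl] := Om k; exists l => // m lm.
  have [C C0 HC] := Hl m lm; exists C => // n.
  have := HC _ (@kothe_coord_continuous n).
  rewrite !dual_norm_coord expe2 -!EFinM lee_fin -expr2.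
  have k0 := weight_gt0 A k n; have l0 := weight_gt0 A l n.
  have m0 := weight_gt0 A m n.
  rewrite -mulrA -invfM ler_pdivlMr ?mulr_gt0// exprVn mulrC.
  by rewrite ler_pdivrMr ?exprn_gt0.
have [C C0 HC] := Hl m lm; exists C => // phi phi_cont.
have k0 := dual_norm_ge0 k phi; have m0 := dual_norm_ge0 m phi.
have l0 := dual_norm_ge0 l phi.
have phik n := dual_norm_delta_le k n phi.
have phim n := dual_norm_delta_le m n phi.
have phil q := @dual_norm_le l phi q phi_cont.
set K := dual_norm (@kothe_norm R A k) phi in k0 phik *.
set M := dual_norm (@kothe_norm R A m) phi in m0 phim *.
set L := dual_norm (@kothe_norm R A l) phi in l0 phil *.
(* As 0 * +oo = 0 in [\bar R], a vanishing factor must be treated apart. *)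
have degenerate : (forall n, normc (phi (kothe_delta A n)) <= 0) ->
    (L ^+ 2 <= C%:E * K * M)%E.
  move=> phi0; have -> : L = 0%E.
    by apply/eqP; rewrite eq_le l0 andbT phil// => n; rewrite mul0r.
  by rewrite expe2 mule0 !mule_ge0// lee_fin ltW.
have [K0|K0] := eqVneq K 0%E.
  by apply: degenerate => n; rewrite -lee_fin (le_trans (phik n))// K0 mule0.
have [M0|M0] := eqVneq M 0%E.
  by apply: degenerate => n; rewrite -lee_fin (le_trans (phim n))// M0 mule0.
(* Both factors are now positive, so an infinite one makes the right-hand side infinite. *)
have [Ky|Kfin] := eqVneq K +oo%E.
  by rewrite Ky gt0_muley ?lte_fin// gt0_mulye ?leey// lt0e M0.
have [My|Mfin] := eqVneq M +oo%E.
  by rewrite My gt0_muley ?leey// mule_gt0 ?lte_fin// lt0e K0.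
have := k0; have := m0; move: phik phim;
  rewrite -(@fineK _ K) ?ge0_fin_numE ?ltey//.
rewrite -(@fineK _ M) ?ge0_fin_numE ?ltey//.
set a := fine K; set b := fine M => phik phim; rewrite !lee_fin => b0 a0.
have q0 : 0 <= C * a * b by rewrite !mulr_ge0// ltW.
(* Multiplying the bounds by the k-th and m-th dual norms at e_n gives |phi(e_n)|^2 <= a_k(n) a_m(n)
   a b <= C a b a_l(n)^2. *)
have Lq : (L <= (Num.sqrt (C * a * b))%:E)%E.
  apply: phil => [|n]; first exact: sqrtr_ge0.
  have ln0 := ltW (weight_gt0 A l n).
  rewrite -[leRHS]ger0_norm ?mulr_ge0 ?sqrtr_ge0//
    -sqrtr_sqr exprMn sqr_sqrtr//.
  rewrite -[leLHS]ger0_norm ?normc_ge0// -sqrtr_sqr ler_wsqrtr//.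
  apply: (@le_trans _ _ ((A k n * a) * (A m n * b))).
    by rewrite expr2 ler_pM ?normc_ge0// -lee_fin ?EFinM.
  have -> : A k n * a * (A m n * b) = a * b * (A k n * A m n) by ring.
  have -> : C * a * b * A l n ^+ 2 = a * b * (C * A l n ^+ 2) by ring.
  by rewrite ler_wpM2l ?mulr_ge0.
rewrite -!EFinM -[X in (_ <= X%:E)%E]sqr_sqrtr//
  [X in (_ <= X%:E)%E]expr2 EFinM expe2.
by rewrite lee_pmul.
Qed.

End kothe_dual.

(** * Prominent sets and the condition on the weights *)

Lemma exists_increasing (P : nat -> nat -> Prop) :
  (forall j N, exists2 n, (N <= n)%N & P j n) ->
  exists f : nat -> nat, {homo f : i j / (i < j)%N} /\ forall j, P j (f j).
Proof.
move=> HP; have /choice[g Hg] : forall jN : nat * nat, exists n,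
  (jN.2 <= n)%N /\ P jN.1 n.
  by move=> [j N]; have [n] := HP j N; exists n.
(* Each value is sought strictly beyond the previous one. *)
pose f := nat_rect (fun=> nat) (g (0, 0)%N) (fun j p => g (j.+1, p.+1)).
exists f; split=> [|[|j]]; last 2 first.
- by have [] := Hg (0, 0)%N.
- by have [] := Hg (j.+1, (f j).+1).
by apply: (homo_ltn ltn_trans) => j; have [] := Hg (j.+1, (f j).+1).
Qed.

Section prominent.
Context {R : realType} (A : kothe_matrix R) (regA : regular A).
Local Notation E := (kothe A).

Lemma kothe_width_nbhs (U : set E) : nbhs (0 : E) U ->
  exists k, exists2 s : R, 0 < s &
  forall l, (k <= l)%N -> forall n (V : set E),
    (kolmogorov_width n V U <= s%:E * kolmogorov_width n V (kothe_unit A l))%E.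
Proof.
move=> /nbhs_kothe_unit[k [s s0 sU]]; exists k, (1 / s);
  first by rewrite divr_gt0.
move=> l kl n V; apply: kolmogorov_width_dilate => //; last exact: sU.
by move=> x Vx; exists x => //; rewrite scale1r.
Qed.

Lemma weight_Omega_bar_prominent :
  weight_Omega_bar A -> has_prominent_set (E : tvsType R[i]).
Proof.
move=> Om.
have {Om} : forall k, exists lC : nat * (nat -> R), (k <= lC.1)%N /\
    forall m, 0 < lC.2 m /\ forall n, A k n * A m n <= lC.2 m * A lC.1 n ^+ 2.
  move=> k; have [l kl Hl] := Om k.
  have /choice[C HC] : forall m, exists C : R,
      0 < C /\ forall n, A k n * A m n <= C * A l n ^+ 2.
    move=> m; have [/Hl[C C0 HC]|ml] := leqP l m; first by exists C.
    (* For m < l both weights on the left are at most a_l(n), so the constant 1 suffices; C is thus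
       total in m. *)
    exists 1; split=> // n; rewrite mul1r expr2.
    by apply: ler_pM; rewrite ?(ltW (weight_gt0 _ _ _))// weight_le// ltnW.
  by exists (l, C).
move=> /choice[lC HlC]; pose l k := (lC k).1; pose C k := (lC k).2.
have kl k : (k <= l k)%N by have [] := HlC k.
have C0 k m : 0 < C k m by have [_ /(_ m)[]] := HlC k.
have HC k m n : A k n * A m n <= C k m * A (l k) n ^+ 2.
  by have [_ /(_ m)[_]] := HlC k.
clearbody l C => {lC HlC}.
(* A diagonal choice: D_m dominates C_{k,m} for the finitely many k <= m, and the factor s_k brings
   C_{k,m} below 1 for the finitely many m < k. *)
pose D m := 1 + \sum_(k < m.+1) C k m.
have D1 m : 1 <= D m by rewrite lerDl sumr_ge0// => k _; exact: ltW.
pose S k := 1 + \sum_(m < k) C k m; pose s k := (S k)^-1.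
have S1 k : 1 <= S k by rewrite lerDl sumr_ge0// => m _; exact: ltW.
have S0 k : 0 < S k := lt_le_trans ltr01 (S1 k).
have s0 k : 0 < s k by rewrite invr_gt0.
have C_le_sum (c : nat -> R) p m : (forall i, 0 < c i) -> (m < p)%N ->
    c m <= 1 + \sum_(i < p) c i.
  move=> c0 mp; rewrite (bigD1 (Ordinal mp))//= addrCA lerDl addr_ge0//.
  by rewrite sumr_ge0// => i _; exact: ltW.
have sCD k m : s k * C k m <= D m.
  have [mk|km] := ltnP m k.
    rewrite (le_trans _ (D1 m))// ler_pdivrMl// mulr1.
    exact: (C_le_sum (C k)).
  apply: (@le_trans _ _ (C k m)).
    by rewrite ler_piMl ?(ltW (C0 _ _))// invf_le1.
  exact: (C_le_sum (C ^~ m)).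
pose B : set E := [set x | forall m, kothe_norm m x <= D m].
have bB : bounded_subset B.
  by apply: kothe_bounded_subset => m; exists (D m) => x; apply.
have width_B k n : ((s k * (A k n / A (l k) n))%:E <=
    kolmogorov_width n B (kothe_unit A (l k)))%E.
  apply: (@kothe_width_ge _ _ _ _ _ _
    (fun j => s k * (A k j / A (l k) j ^+ 2))) => j jn.
  have k0 := weight_gt0 A k j; have l0 := weight_gt0 A (l k) j.
  have t0 : 0 < s k * (A k j / A (l k) j ^+ 2).
    by rewrite mulr_gt0// divr_gt0// exprn_gt0.
  split=> //.
    move=> m; rewrite kothe_normZ kothe_norm_delta normc_real ?(ltW t0)//.
    apply: le_trans (sCD k m); rewrite -mulrA ler_wpM2l ?(ltW (s0 _))//.
    by rewrite mulrAC ler_pdivrMr ?exprn_gt0.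
  rewrite -!mulrA ler_wpM2l ?(ltW (s0 _))// expr2 invfM -[(_ * _) * A _ j]mulrA.
  by rewrite mulVf ?gt_eqF// mulr1 regular_le.
exists B; split=> //; apply/seteqP; split;
  first exact: diametral_dimension_sub_bounded.
move=> xi Bxi U [nU _].
have [k [r r0 rU]] := kothe_width_nbhs nU.
(* The n-th width of this ball in U is at most r a_k(n) / a_l(n), which [width_B] bounds by r / s_k
   times the width of B in the same ball. *)
exists (kothe_unit A (l k)); first exact: kothe_unit_absconvex.
apply: (@width_null_le _ _ _ _ _ B (kothe_unit A (l k)) (r / s k) 0).
- by rewrite divr_gt0.
- move=> n _; apply: le_trans (rU k (leqnn k) n _) _.
  rewrite EFinM -muleA lee_wpmul2l ?lee_fin ?(ltW r0)//.
  apply: le_trans (kothe_width_le n regA (kl k)) _.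
  by rewrite lee_pdivlMl// -EFinM.
- exact/Bxi/kothe_unit_absconvex.
Qed.

Lemma prominent_width_ge (B : set E) k : prominent B ->
  exists2 l, (k <= l)%N & exists2 C : R, 0 < C &
  exists N, forall n, (N <= n)%N ->
    ((A k n / A l n)%:E <= C%:E * kolmogorov_width n B (kothe_unit A l))%E.
Proof.
move=> [_ DE]; apply: contrapT => nH.
pose w j n := kolmogorov_width n B (kothe_unit A (k + j)).
(* The failing estimate is used with l = k + j and C = j + 1, so index and constant grow
   together. *)
have /exists_increasing[f [f_homo Hf]] : forall j N, exists2 n, (N <= n)%N &
    (j.+1%:R%:E * w j n < (A k n / A (k + j)%N n)%:E)%E.
  move=> j N; apply: contrapT => nj; apply: nH.
  exists (k + j)%N; first exact: leq_addr.
  exists j.+1%:R => //; exists N => n Nn; rewrite leNgt; apply/negP => h.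
  by apply: nj; exists n.
have f_mono := leq_mono f_homo.
have f_ge j : (j <= f j)%N.
  by elim: j => // j ih; apply: leq_ltn_trans ih _; exact: f_homo.
have /choice[xi Hxi] : forall n, exists r : R,
    (exists2 j, f j = n & r = A (k + j)%N n / A k n) \/
    ((forall j, f j <> n) /\ r = 0).
  move=> n; have [[j fj]|nfj] := pselect (exists j, f j = n).
    by exists (A (k + j)%N n / A k n); left; exists j.
  by exists 0; right; split=> // j fj; apply: nfj; exists j.
have xif j : xi (f j) = A (k + j)%N (f j) / A k (f j).
  have [[i fij ->]|[/(_ j)]//] := Hxi (f j).
  suff -> : i = j by [].
  by apply/eqP; rewrite eqn_leq -(f_mono i) -(f_mono j) fij leqnn.
have w_mono i j n : (i <= j)%N -> (w i n <= w j n)%E.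
  move=> ij; apply: kolmogorov_width_subr => x; apply: le_trans.
  by rewrite kothe_norm_le// leq_add2l.
have xi_null i : width_null xi B (kothe_unit A (k + i)).
  apply/width_nullP => e e0.
  (* For j >= J the i-th width is at most the j-th, and 1 / (j + 1) <= e. *)
  pose J := maxn i (Num.truncn e^-1).
  exists (f J) => n fJn; have [[j fj xin]|[_ ->]] := Hxi n; last first.
    by rewrite normr0 mul0e lee_fin ltW.
  have : (J <= j)%N by rewrite -f_mono fj.
  rewrite geq_max => /andP[ij ej].
  have k0 := weight_gt0 A k n; have j0 := weight_gt0 A (k + j)%N n.
  have x0 : 0 < xi n by rewrite xin divr_gt0.
  rewrite gtr0_norm//; apply: (@le_trans _ _ ((xi n)%:E * w j n)%E).
    by rewrite lee_wpmul2l ?lee_fin ?(ltW x0)// w_mono.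
  apply: (@le_trans _ _ (j.+1%:R^-1)%:E); last first.
    rewrite lee_fin invf_ple ?posrE// ltW//.
    by rewrite (lt_le_trans (truncnS_gt _))// ler_nat ltnS.
  rewrite -lee_pdivlMl// -EFinM xin invf_div.
  have := ltW (Hf j); rewrite fj -lee_pdivlMl// -EFinM.
  by rewrite [X in (_ <= X%:E)%E]mulrC.
have : diametral_dimension E xi.
  rewrite DE => U [nU _]; have [l [s s0 lU]] := kothe_width_nbhs nU.
  apply: (@width_null_le _ _ _ _ _ B (kothe_unit A (k + l)%N) s 0) => // n _.
  exact/lU/leq_addl.
move=> /(_ _ (kothe_unit_absconvex A k))[V [nV _] xiV].
have [i [s s0 iV]] := nbhs_kothe_unit nV.
have {xiV} : width_null xi (kothe_unit A (k + i)) (kothe_unit A k).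
  apply: (@width_null_le _ _ _ _ _ V (kothe_unit A k) s^-1 0) => //.
    by rewrite invr_gt0.
  move=> n _; rewrite -[s^-1]divr1; apply: kolmogorov_width_dilate => //.
  - by rewrite invr_gt0.
  - move=> x x1; exists (s%:C *: x).
      by apply: (iV (k + i)%N) => //; [exact: leq_addl | exists x].
    by rewrite scalerA -rmorphM/= mulVf ?gt_eqF// scale1r.
  - by move=> _ [x x1 <-]; rewrite scale1r.
(* At n = f j with j >= i the product is at least a_{k+j}(n) / a_{k+i}(n) >= 1, which contradicts a
   limit of zero. *)
move=> /width_nullP/(_ 2^-1)[|N]; first by rewrite invr_gt0.
pose j := maxn i N; move=> /(_ (f j) (leq_trans (leq_maxr _ _) (f_ge j))).
apply/negP; rewrite -ltNge xif.
set n := f j; have k0 := weight_gt0 A k n; have j0 := weight_gt0 A (k + j)%N n.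
have i0 := weight_gt0 A (k + i)%N n.
rewrite gtr0_norm ?divr_gt0//.
apply: (@lt_le_trans _ _ 1%E); first by rewrite lte_fin invf_lt1// ltr1n.
apply: (@le_trans _ _
  ((A (k + j)%N n / A k n)%:E * (A k n / A (k + i)%N n)%:E)%E).
  rewrite -EFinM lee_fin mulrA divfK ?gt_eqF// ler_pdivlMr// mul1r.
  by rewrite weight_le// leq_add2l leq_maxl.
by rewrite lee_wpmul2l ?lee_fin ?divr_ge0 ?(ltW k0) ?(ltW j0)//
  kothe_width_unit_ge// leq_addr.
Qed.

(** Prominence fixes l before m is given; only the absorption radius r and the correction S depend
    on m, as the order of quantifiers requires. *)
Lemma prominent_weight_Omega_bar :
  has_prominent_set (E : tvsType R[i]) -> weight_Omega_bar A.
Proof.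
move=> [B pB] k; have [l kl [C C0 [N HN]]] := prominent_width_ge k pB.
exists l => // m lm; have [r r0 Br] := bounded_subset_kothe m pB.1.
pose S := \sum_(i < N) A k i * A m i / A l i ^+ 2.
have ratio_ge0 n : 0 <= A k n * A m n / A l n ^+ 2.
  by rewrite divr_ge0 ?mulr_ge0 ?exprn_ge0 ?(ltW (weight_gt0 _ _ _)).
have S0 : 0 <= S by rewrite sumr_ge0.
exists (C * r + S); first by rewrite ltr_wpDr// mulr_gt0.
move=> n; have k0 := weight_gt0 A k n; have l0 := weight_gt0 A l n.
have m0 := weight_gt0 A m n.
rewrite -ler_pdivrMr ?exprn_gt0//; have [Nn|nN] := leqP N n; last first.
  rewrite /S (bigD1 (Ordinal nN))//= addrCA lerDl addr_ge0 ?sumr_ge0//.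
  by rewrite mulr_ge0 ?ltW.
rewrite ler_wpDr// ler_pdivrMr ?exprn_gt0//.
have : ((A k n / A l n)%:E <= (C * (r * (A l n / A m n)))%:E)%E.
  apply: le_trans (HN n Nn) _; rewrite EFinM lee_wpmul2l ?lee_fin ?(ltW C0)//.
  have dil1 : dilate 1 (kothe_unit A l) `<=` kothe_unit A l.
    by move=> _ [x x1 <-]; rewrite scale1r.
  apply: le_trans (kolmogorov_width_dilate n r0 ltr01 Br dil1) _.
  rewrite divr1 EFinM lee_wpmul2l ?lee_fin ?(ltW r0)//.
  exact: kothe_width_le.
rewrite lee_fin ler_pdivrMr// => h; rewrite -ler_pdivlMr//.
by apply: le_trans h _; rewrite le_eqVlt; apply/orP; left; apply/eqP; ring.
Qed.

End prominent.

Theorem proposition2p2 (R : realType) (A : kothe_matrix R) (A_regular : regular A) :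
  has_prominent_set (kothe A : tvsType R[i]) <-> Omega_bar (@kothe_norm R A).
Proof.
rewrite Omega_barP; split.
  exact: prominent_weight_Omega_bar.
exact: weight_Omega_bar_prominent.
Qed.
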